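(* Let $\pi:(M^3(c),g)\to(N^2(c),h)$ be a Riemannian submersion from a 3-space form of constant sectional curvature $c$ into a surface of constant Gauss curvature $c$, with an adapted frame $\{e_1,e_2,e_3\}$ and integrability data $f_1,f_2,\kappa_1,\kappa_2,\sigma$ with $\kappa_2=0$ and $\kappa_1\neq0$, and let $f:M\to(0,+\infty)$. Then $\pi$ is proper $f$-biharmonic if and only if $$\begin{cases} -\Delta^M(f\kappa_1)+f\kappa_1(-c+c^2/\kappa_1^2)=0,\\ c\,e_2(f)=0,\\ -\Delta^M(\kappa_1)+\kappa_1(-c+c^2/\kappa_1^2)\neq0. \end{cases}$$
   Context: An adapted frame of $\pi$ is an orthonormal frame $\{e_1,e_2,e_3\}$ on $M$ with $e_3$ vertical and $e_1,e_2$ basic horizontal, $d\pi(e_i)=\varepsilon_i$ ($i=1,2$) with $\{\varepsilon_1,\varepsilon_2\}$ an orthonormal frame on $N$. The integrability data are the functions defined by $$[e_1,e_3]=\kappa_1e_3,\quad[e_2,e_3]=\kappa_2e_3,\quad[e_1,e_2]=f_1e_1+f_2e_2-2\sigma e_3.$$ The submersion may be defined only on an open subset of the space form onto an open subset of the surface. $\Delta^M=\mathrm{div}\,\mathrm{grad}$ on $(M,g)$. For a map $\varphi:(M,g)\to(N,h)$, $\tau(\varphi)=\mathrm{Trace}_g\nabla d\varphi$, $\tau_2(\varphi)=\mathrm{Trace}_g(\nabla^\varphi\nabla^\varphi-\nabla^\varphi_{\nabla^M})\tau(\varphi)-\mathrm{Trace}_gR^N(d\varphi,\tau(\varphi))d\varphi$,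 with $R^N(X,Y)Z=[\nabla_X,\nabla_Y]Z-\nabla_{[X,Y]}Z$. The map is biharmonic if $\tau_2(\varphi)=0$, $f$-biharmonic if $f\tau_2(\varphi)+(\Delta f)\tau(\varphi)+2\nabla^\varphi_{\mathrm{grad}f}\tau(\varphi)=0$, and proper $f$-biharmonic if it is $f$-biharmonic but not biharmonic. *)

(* Defs.v *)
From HB Require Import structures.
From mathcomp Require Import all_boot all_order all_algebra.
From mathcomp Require Import all_classical all_reals all_analysis.
From mathcomp Require Import ring.

Set Implicit Arguments.
Unset Strict Implicit.
Unset Printing Implicit Defensive.

Import Order.TTheory GRing.Theory Num.Theory.
Import numFieldNormedType.Exports.

Local Open Scope classical_set_scope.
Local Open Scope ring_scope.

(* Only meant for open U: all partial derivatives of order <= k exist and are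
   continuous on U. *)

Fixpoint Ck (R : realType) (n k : nat) (U : set 'rV[R]_n) (f : 'rV[R]_n -> R)
    : Prop :=
  (forall x, U x -> {for x, continuous f}) /\
  (if k is k'.+1 then
     forall i : 'I_n,
       (forall x, U x -> derivable f x (delta_mx 0 i)) /\
       Ck k' U (fun x => 'D_(delta_mx 0 i) f x)
   else True).

Definition Cinfty (R : realType) (n : nat) (U : set 'rV[R]_n)
    (f : 'rV[R]_n -> R) : Prop :=
  forall k, Ck k U f.

Section CkTheory.
Variables (R : realType) (n : nat) (U : set 'rV[R]_n).
Hypothesis oU : open U.
Implicit Types f g : 'rV[R]_n -> R.

Lemma Ck_cont k f x : Ck k U f -> U x -> {for x, continuous f}.
Proof. by case: k => [|k] /= [h _]; exact: h. Qed.

Lemma CkS k f : Ck k.+1 U f -> Ck k U f.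
Proof.
elim: k f => [|k IH] f; first by case.
case=> fc fd; split=> // i; have [fi di] := fd i; split=> //.
exact: IH.
Qed.

Lemma near_eq_on x (f g : 'rV[R]_n -> R) :
  U x -> (forall y, U y -> f y = g y) -> \forall y \near x, f y = g y.
Proof. by move=> Ux UP; apply: filterS (open_nbhs_nbhs (conj oU Ux)). Qed.

Lemma Ck_ext k f g : (forall x, U x -> f x = g x) -> Ck k U f -> Ck k U g.
Proof.
elim: k f g => [|k IH] f g fg [fc fd]; split => //.
- move=> x Ux; rewrite /prop_for /continuous_at -(fg x Ux).
  exact: cvg_trans
    (@near_eq_cvg _ _ (nbhs x) _ f g (near_eq_on Ux fg)) (fc x Ux).
- move=> x Ux; rewrite /prop_for /continuous_at -(fg x Ux).
  exact: cvg_trans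
    (@near_eq_cvg _ _ (nbhs x) _ f g (near_eq_on Ux fg)) (fc x Ux).
- move=> i; have [fi di] := fd i; split.
    move=> x Ux; apply: near_eq_derivable (fi x Ux); exact: near_eq_on Ux fg.
  apply: IH di => x Ux; apply: near_eq_derive; exact: near_eq_on Ux fg.
Qed.

Lemma Ck_cst k (c : R) : Ck k U (cst c).
Proof.
elim: k c => [|k IH] c /=; split => //; try by move=> x _; exact: cst_continuous.
move=> i; split; first by move=> x _; exact: derivable_cst.
by apply: (Ck_ext _ (IH 0)) => x _; rewrite derive_cst.
Qed.

Lemma CkD k f g : Ck k U f -> Ck k U g -> Ck k U (f + g).
Proof.
elim: k f g => [|k IH] f g /= [fc fd] [gc gd]; split => //;
  try by move=> x Ux; apply: continuousD; [exact: fc|exact: gc].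
move=> i; have [fi fki] := fd i; have [gi gki] := gd i; split.
  by move=> x Ux; apply: derivableD; [exact: fi|exact: gi].
apply: Ck_ext (IH _ _ fki gki) => x Ux.
by rewrite deriveD//; [exact: fi|exact: gi].
Qed.

Lemma CkM k f g : Ck k U f -> Ck k U g -> Ck k U (f * g).
Proof.
elim: k f g => [|k IH] f g; first by
  move=> /= [fc _] [gc _]; split => // x Ux;
  apply: continuousM; [exact: fc|exact: gc].
move=> fk gk; have fk' := CkS fk; have gk' := CkS gk.
case: fk gk => [fc fd] [gc gd]; split => //.
  by move=> x Ux; apply: continuousM; [exact: fc|exact: gc].
move=> i; have [fi fki] := fd i; have [gi gki] := gd i; split.
  by move=> x Ux; apply: derivableM; [exact: fi|exact: gi].
apply: Ck_ext (CkD (IH _ _ fk' gki) (IH _ _ gk' fki)) => x Ux.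
by rewrite deriveM//; [exact: fi|exact: gi].
Qed.

End CkTheory.

(* [chart_inv] is a total function; only its values on the (open) image
   [chart_cod] of the chart matter. *)
Record chart (R : realType) (n : nat) (T : topologicalType) := Chart {
  chart_dom : set T;
  chart_map : T -> 'rV[R]_n;
  chart_inv : 'rV[R]_n -> T;
  chart_dom_open : open chart_dom;
  chart_cod_open : open (chart_map @` chart_dom);
  chart_mapK : forall p, chart_dom p -> chart_inv (chart_map p) = p;
  chart_map_cont : forall p, chart_dom p -> {for p, continuous chart_map};
  chart_inv_cont : forall x, (chart_map @` chart_dom) x ->
    {for x, continuous chart_inv} }.

Arguments chart_dom_open {R n T} c.
Arguments chart_cod_open {R n T} c.

Definition compatible (R : realType) (n : nat) (T : topologicalType)
    (x y : chart R n T) : Prop :=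
  forall j : 'I_n,
    Cinfty (chart_map x @` (chart_dom x `&` chart_dom y))
           (fun a => chart_map y (chart_inv x a) 0 j).

Record manifold (R : realType) (n : nat) := Manifold {
  carrier :> topologicalType;
  manifold_hausdorff : hausdorff_space carrier;
  manifold_second_countable : @second_countable carrier;
  atlas : set (chart R n carrier);
  atlas_cover : forall p : carrier, exists2 x, atlas x & chart_dom x p;
  atlas_compatible : forall x y, atlas x -> atlas y -> compatible x y }.

Definition smooth_on (R : realType) (n : nat) (M : manifold R n) (U : set M)
    (u : M -> R) : Prop :=
  forall x, atlas x ->
    Cinfty (chart_map x @` (chart_dom x `&` U)) (u \o chart_inv x).

Definition smooth_fun (R : realType) (n : nat) (M : manifold R n)
    : {pred (M -> R)} :=
  fun u => `[< smooth_on setT u >].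
Arguments smooth_fun {R n} M.

Section SmoothFun.
Variables (R : realType) (n : nat) (M : manifold R n).

Lemma smooth_funP (u : M -> R) : reflect (smooth_on setT u) (u \in smooth_fun M).
Proof. exact: asboolP. Qed.

Lemma smooth_onE (u : M -> R) : smooth_on setT u <->
  forall x, atlas x -> Cinfty (chart_map x @` chart_dom x) (u \o chart_inv x).
Proof. by split=> h x xM; have := h x xM; rewrite setIT. Qed.

Lemma smooth_cst (c : R) : (fun=> c) \in smooth_fun M.
Proof.
by apply/smooth_funP/smooth_onE => x _ k; exact: (Ck_cst (chart_cod_open x) k c).
Qed.

Lemma smoothD (u v : M -> R) : u \in smooth_fun M -> v \in smooth_fun M ->
  u + v \in smooth_fun M.
Proof.
move=> /smooth_funP/smooth_onE su /smooth_funP/smooth_onE sv.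
apply/smooth_funP/smooth_onE => x xM k.
exact: (CkD (chart_cod_open x) (su x xM k) (sv x xM k)).
Qed.

Lemma smoothM (u v : M -> R) : u \in smooth_fun M -> v \in smooth_fun M ->
  u * v \in smooth_fun M.
Proof.
move=> /smooth_funP/smooth_onE su /smooth_funP/smooth_onE sv.
apply/smooth_funP/smooth_onE => x xM k.
exact: (CkM (chart_cod_open x) (su x xM k) (sv x xM k)).
Qed.

Lemma smooth_subring : subring_closed (smooth_fun M).
Proof.
split=> [|u v su sv|u v]; [exact: smooth_cst| |exact: smoothM].
have -> : u - v = u + cst (-1) * v.
  by apply/funext => p; rewrite /GRing.mul/= /GRing.add/= /GRing.opp/= mulN1r.
by apply: smoothD => //; apply: smoothM => //; exact: smooth_cst.
Qed.

HB.instance Definition _ :=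
  GRing.isSubringClosed.Build (M -> R) (smooth_fun M) smooth_subring.

End SmoothFun.

Record cinf (R : realType) (n : nat) (M : manifold R n) := Cinf {
  cinf_fun :> M -> R;
  cinf_smooth : cinf_fun \in smooth_fun M }.

Section CinfAlgebra.
Variables (R : realType) (n : nat) (M : manifold R n).

HB.instance Definition _ := [isSub for (@cinf_fun R n M)].
HB.instance Definition _ := [Choice of cinf M by <:].
HB.instance Definition _ := GRing.SubChoice_isSubComPzRing.Build
  (M -> R) (smooth_fun M) (cinf M) (@smooth_subring R n M).

Lemma cinf_scale_subproof (a : R) (u : cinf M) :
  (fun p => a * u p) \in smooth_fun M.
Proof. by apply: (@smoothM _ _ _ (cst a)); [exact: smooth_cst|exact: cinf_smooth]. Qed.

Definition cinf_scale (a : R) (u : cinf M) : cinf M :=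
  Cinf (cinf_scale_subproof a u).

Lemma cinf_scaleA a b u : cinf_scale a (cinf_scale b u) = cinf_scale (a * b) u.
Proof. by apply/val_inj/funext => p /=; rewrite mulrA. Qed.
Lemma cinf_scale1 : left_id 1 cinf_scale.
Proof. by move=> u; apply/val_inj/funext => p /=; rewrite mul1r. Qed.
Lemma cinf_scaleDr : right_distributive cinf_scale +%R.
Proof. by move=> a u v; apply/val_inj/funext => p /=; rewrite mulrDr. Qed.
Lemma cinf_scaleDl u : {morph cinf_scale^~ u : a b / a + b}.
Proof. by move=> a b; apply/val_inj/funext => p /=; rewrite mulrDl. Qed.

HB.instance Definition _ := GRing.Zmodule_isLmodule.Build R (cinf M)
  cinf_scaleA cinf_scale1 cinf_scaleDr cinf_scaleDl.

End CinfAlgebra.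

(* T_pM is the space of derivations of the algebra C^oo(M) at p. *)

Definition derivation_at (R : realType) (n : nat) (M : manifold R n) (p : M)
    : {pred (cinf M -> R^o)} :=
  fun D => `[< (forall (a : R) (u v : cinf M), D (a *: u + v) = a * D u + D v)
            /\ (forall u v : cinf M, D (u * v) = u p * D v + v p * D u) >].
Arguments derivation_at {R n M} p.

Record tangent (R : realType) (n : nat) (M : manifold R n) (p : M) := Tangent {
  tangent_fun :> cinf M -> R^o;
  tangentP : tangent_fun \in derivation_at p }.

Section TangentSpace.
Variables (R : realType) (n : nat) (M : manifold R n) (p : M).

Lemma derivation_submod : submod_closed (@derivation_at R n M p).
Proof.
split=> [|a D E /asboolP[Dl DM] /asboolP[El EM]]; apply/asboolP; split.
- by move=> a u v /=; rewrite mulr0 addr0.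
- by move=> u v; rewrite !mulr0 addr0.
- move=> b u v; rewrite !fctE/= Dl El.
  by rewrite /GRing.scale/=; ring.
- move=> u v; rewrite !fctE/= DM EM.
  by rewrite /GRing.scale/=; ring.
Qed.

HB.instance Definition _ := GRing.isSubmodClosed.Build R (cinf M -> R^o)
  (@derivation_at R n M p) derivation_submod.

HB.instance Definition _ := [isSub for (@tangent_fun R n M p)].
HB.instance Definition _ := [Choice of tangent p by <:].
HB.instance Definition _ := [SubChoice_isSubLmodule of tangent p by <:].

Lemma tangent_linear (v : tangent p) (a : R) (u w : cinf M) :
  v (a *: u + w) = a * v u + v w.
Proof. by have /asboolP[+ _] := tangentP v; exact. Qed.

Lemma tangent_leibniz (v : tangent p) (u w : cinf M) :
  v (u * w) = u p * v w + w p * v u.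
Proof. by have /asboolP[_ +] := tangentP v; exact. Qed.

End TangentSpace.

(* Smooth sections of phi^*TN; vector fields are sections along the identity. *)

Record section (R : realType) (m n : nat) (M : manifold R m) (N : manifold R n)
    (phi : M -> N) := Section {
  section_fun :> forall p : M, tangent (phi p);
  section_smooth : forall u : cinf N, (fun p => section_fun p u) \in smooth_fun M }.

Notation vfield M := (section (fun p : carrier M => p)).

Section Sections.
Variables (R : realType) (m n : nat) (M : manifold R m) (N : manifold R n).
Variable phi : M -> N.
Implicit Types (V W : section phi) (a : cinf M) (u : cinf N).

HB.instance Definition _ := gen_eqMixin (section phi).
HB.instance Definition _ := gen_choiceMixin (section phi).

(* V u : p |-> V_p(u) *)
Definition section_app V u : cinf M := Cinf (section_smooth V u).

Lemma section0_smooth u : (fun p : M => (0 : tangent (phi p)) u) \in smooth_fun M.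
Proof. exact: (smooth_cst M 0). Qed.
Definition section0 : section phi := Section section0_smooth.

Lemma sectionD_smooth V W u : (fun p : M => (V p + W p) u) \in smooth_fun M.
Proof. exact: (smoothD (section_smooth V u) (section_smooth W u)). Qed.
Definition sectionD V W : section phi := Section (sectionD_smooth V W).

Lemma sectionM_smooth a V u : (fun p : M => (a p *: V p) u) \in smooth_fun M.
Proof. exact: (smoothM (cinf_smooth a) (section_smooth V u)). Qed.
Definition sectionM a V : section phi := Section (sectionM_smooth a V).

(* A field of vectors along phi, seen as a smooth section (when it is smooth). *)
Definition to_section (V : forall p : M, tangent (phi p)) : section phi :=
  xget section0 [set W : section phi | forall p, W p = V p].

End Sections.

Section Bracket.
Variables (R : realType) (n : nat) (M : manifold R n).
Implicit Types X Y : vfield M.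

Lemma section_app_linear X (a : R) (u w : cinf M) :
  section_app X (a *: u + w) = a *: section_app X u + section_app X w.
Proof. by apply/val_inj/funext => p /=; rewrite tangent_linear. Qed.

Lemma section_app_leibniz X (u w : cinf M) :
  section_app X (u * w) = u * section_app X w + w * section_app X u.
Proof. by apply/val_inj/funext => p /=; rewrite tangent_leibniz. Qed.

Lemma bracket_tangent X Y (p : M) :
  (fun u => X p (section_app Y u) - Y p (section_app X u)) \in derivation_at p.
Proof.
have tD (v : tangent p) (u w : cinf M) : v (u + w) = v u + v w.
  by have := tangent_linear v 1 u w; rewrite scale1r mul1r.
apply/asboolP; split=> [a u w|u w].
  by rewrite !section_app_linear !tangent_linear; ring.
rewrite !section_app_leibniz !tD !tangent_leibniz /=; ring.
Qed.

Lemma bracket_smooth X Y (u : cinf M) :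
  (fun p => Tangent (bracket_tangent X Y p) u) \in smooth_fun M.
Proof.
exact: (cinf_smooth (section_app X (section_app Y u)
                     - section_app Y (section_app X u))).
Qed.

Definition bracket X Y : vfield M := Section (bracket_smooth X Y).

(* A global field with prescribed value v at p. It is only used to evaluate at p
   expressions that are tensorial in the field, so the choice is irrelevant. *)
Definition extend (p : M) (v : tangent p) : vfield M :=
  xget (section0 _) [set X : vfield M | X p = v].

End Bracket.

(* phi is smooth when it is continuous and pulls smooth functions on open
   subsets of N back to smooth functions. *)
Record smap (R : realType) (m n : nat) (M : manifold R m) (N : manifold R n) :=
  Smap {
  smap_fun :> M -> N;
  smap_cont : continuous smap_fun;
  smap_smooth : forall (V : set N) (u : N -> R), open V -> smooth_on V u ->
    smooth_on (smap_fun @^-1` V) (u \o smap_fun) }.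

Section Differential.
Variables (R : realType) (m n : nat) (M : manifold R m) (N : manifold R n).
Variable phi : smap M N.

Lemma pullback_smooth (u : cinf N) : u \o phi \in smooth_fun M.
Proof.
apply/smooth_funP; rewrite -(preimage_setT phi).
by apply: smap_smooth; [exact: openT|apply/smooth_funP; exact: cinf_smooth].
Qed.
Definition pullback (u : cinf N) : cinf M := Cinf (pullback_smooth u).

Lemma differential_tangent (p : M) (v : tangent p) :
  (fun u => v (pullback u)) \in derivation_at (phi p).
Proof.
have pbl a u w : pullback (a *: u + w) = a *: pullback u + pullback w.
  exact: val_inj.
have pbM u w : pullback (u * w) = pullback u * pullback w by exact: val_inj.
apply/asboolP; split=> [a u w|u w]; first by rewrite pbl tangent_linear.
by rewrite pbM tangent_leibniz.
Qed.

Definition differential (p : M) (v : tangent p) : tangent (phi p) :=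
  Tangent (differential_tangent v).

Definition push_field (X : vfield M) : section phi :=
  @Section _ _ _ _ _ phi (fun p => differential (X p))
    (fun u => section_smooth X (pullback u)).

Definition pull_field (Y : vfield N) : section phi :=
  @Section _ _ _ _ _ phi (fun p => Y (phi p))
    (fun u => pullback_smooth (section_app Y u)).

End Differential.

(* A connection on phi^*TN; for phi the identity, a connection on TM. *)
Record connection (R : realType) (m n : nat) (M : manifold R m)
    (N : manifold R n) (phi : M -> N) := Connection {
  cov :> forall p : M, tangent p -> section phi -> tangent (phi p);
  cov_linear : forall (p : M) (a : R) (v w : tangent p) (V : section phi),
    cov (a *: v + w) V = a *: cov v V + cov w V;
  covD : forall (p : M) (v : tangent p) (V W : section phi),
    cov v (sectionD V W) = cov v V + cov v W;
  cov_leibniz : forall (p : M) (v : tangent p) (a : cinf M) (V : section phi),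
    cov v (sectionM a V) = v a *: V p + a p *: cov v V;
  cov_smooth : forall (X : vfield M) (V : section phi) (u : cinf N),
    (fun p => cov (X p) V u) \in smooth_fun M }.

Notation affine_connection M := (connection (fun p : carrier M => p)).

Definition cov_section (R : realType) (m n : nat) (M : manifold R m)
    (N : manifold R n) (phi : M -> N) (D : connection phi)
    (X : vfield M) (V : section phi) : section phi :=
  Section (cov_smooth D X V).

(* This property determines the pull-back connection uniquely. *)
Definition is_pullback_connection (R : realType) (m n : nat) (M : manifold R m)
    (N : manifold R n) (phi : smap M N) (DN : affine_connection N)
    (D : connection phi) : Prop :=
  forall (p : M) (v : tangent p) (Y : vfield N),
    D p v (pull_field phi Y) = DN (phi p) (differential phi v) Y.

(* R(x, y)z, where R(X, Y)Z = [D_X, D_Y]Z - D_[X, Y]Z *)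
Definition curvature (R : realType) (n : nat) (M : manifold R n)
    (D : affine_connection M) (p : M) (x y z : tangent p) : tangent p :=
  let X := extend x in let Y := extend y in let Z := extend z in
  D p x (cov_section D Y Z) - D p y (cov_section D X Z) - D p (bracket X Y p) Z.

Record metric (R : realType) (n : nat) (M : manifold R n) := Metric {
  metric_fun :> forall p : M, tangent p -> tangent p -> R;
  metric_linear : forall (p : M) (a : R) (u v w : tangent p),
    metric_fun (a *: u + v) w = a * metric_fun u w + metric_fun v w;
  metric_sym : forall (p : M) (v w : tangent p), metric_fun v w = metric_fun w v;
  metric_gt0 : forall (p : M) (v : tangent p), v != 0 -> 0 < metric_fun v v;
  metric_smooth : forall X Y : vfield M,
    (fun p => metric_fun (X p) (Y p)) \in smooth_fun M }.

Section Riemannian.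
Variables (R : realType) (n : nat) (M : manifold R n) (g : metric M).

Definition metric_app (X Y : vfield M) : cinf M := Cinf (metric_smooth g X Y).

Definition levi_civita (D : affine_connection M) : Prop :=
  (forall (X Y : vfield M) (p : M),
     D p (X p) Y - D p (Y p) X = bracket X Y p) /\
  (forall (X Y Z : vfield M) (p : M),
     X p (metric_app Y Z) = g p (D p (X p) Y) (Z p) + g p (Y p) (D p (X p) Z)).

Definition orthonormal_basis (p : M) (b : 'I_n -> tangent p) : Prop :=
  (forall i j, g p (b i) (b j) = (i == j)%:R) /\
  (forall v : tangent p, exists a : 'I_n -> R, v = \sum_i a i *: b i).

Definition orthonormal_frame (E : 'I_n -> vfield M) : Prop :=
  forall p : M, orthonormal_basis (fun i => E i p).

(* Trace_g B at p; B is meant to be bilinear, and then the choice of the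
   orthonormal basis is irrelevant. *)
Definition trace_g (W : lmodType R) (p : M) (B : tangent p -> tangent p -> W)
    : W :=
  let b := xget (fun=> 0) [set b : 'I_n -> tangent p | orthonormal_basis b] in
  \sum_i B (b i) (b i).

(* the field with g(grad u, v) = v(u), unique as g is positive definite *)
Definition grad (u : cinf M) : vfield M :=
  xget (section0 _)
    [set G : vfield M | forall p (v : tangent p), g p (G p) v = v u].

Definition divergence (D : affine_connection M) (X : vfield M) (p : M) : R :=
  trace_g (W := R^o) (fun v w : tangent p => g p (D p v X) w).

Definition laplacian (D : affine_connection M) (u : cinf M) (p : M) : R :=
  divergence D (grad u) p.

Definition sectional_curvature (D : affine_connection M) (p : M)
    (x y : tangent p) : R :=
  g p (curvature D x y y) x / (g p x x * g p y y - g p x y ^+ 2).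

Definition constant_curvature (D : affine_connection M) (c : R) : Prop :=
  forall (p : M) (x y : tangent p),
    (forall a b : R, a *: x + b *: y = 0 -> a = 0 /\ b = 0) ->
    sectional_curvature D x y = c.

End Riemannian.

(* DM and DN are meant to be the Levi-Civita connections of M and N, and D the
   pull-back of DN by phi. *)
Section Biharmonic.
Variables (R : realType) (m n : nat) (M : manifold R m) (N : manifold R n).
Variables (g : metric M) (DM : affine_connection M) (DN : affine_connection N).
Variables (phi : smap M N) (D : connection phi).

Definition second_fundamental_form (p : M) (v w : tangent p) : tangent (phi p) :=
  D p v (push_field phi (extend w)) - differential phi (DM p v (extend w)).

Definition tension : section phi :=
  to_section (fun p => trace_g g (@second_fundamental_form p)).

Definition second_derivative (V : section phi) (p : M) (v w : tangent p)
    : tangent (phi p) :=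
  D p v (cov_section D (extend w) V) - D p (DM p v (extend w)) V.

Definition bitension (p : M) : tangent (phi p) :=
  trace_g g (@second_derivative tension p)
  - trace_g g (fun v w : tangent p =>
      curvature DN (differential phi v) (tension p) (differential phi w)).

Definition biharmonic : Prop := forall p : M, bitension p = 0.

Definition f_biharmonic (f : cinf M) : Prop :=
  forall p : M,
    f p *: bitension p + laplacian g DM f p *: tension p
      + 2%:R *: D p (grad g f p) tension = 0.

Definition proper_f_biharmonic (f : cinf M) : Prop :=
  f_biharmonic f /\ ~ biharmonic.

End Biharmonic.

Section Submersion.
Variables (R : realType) (m n : nat) (M : manifold R m) (N : manifold R n).
Variables (g : metric M) (h : metric N) (pi : smap M N).

Definition vertical (p : M) (v : tangent p) : Prop := differential pi v = 0.

Definition horizontal (p : M) (v : tangent p) : Prop :=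
  forall w : tangent p, vertical w -> g p v w = 0.

Definition riemannian_submersion : Prop :=
  [/\ (forall q : N, exists p : M, pi p = q),
      (forall (p : M) (w : tangent (pi p)),
         exists v : tangent p, differential pi v = w)
    & (forall (p : M) (v w : tangent p), horizontal v -> horizontal w ->
         h (pi p) (differential pi v) (differential pi w) = g p v w)].

End Submersion.

Definition adapted_frame (R : realType) (M : manifold R 3) (N : manifold R 2)
    (g : metric M) (h : metric N) (pi : smap M N)
    (e1 e2 e3 : vfield M) (eps1 eps2 : vfield N) : Prop :=
  [/\ orthonormal_frame g (tnth [tuple e1; e2; e3]),
      orthonormal_frame h (tnth [tuple eps1; eps2]),
      (forall p : M, vertical pi (e3 p)),
      (forall p : M, horizontal g pi (e1 p) /\ horizontal g pi (e2 p))
    & (forall p : M, differential pi (e1 p) = eps1 (pi p) /\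
                     differential pi (e2 p) = eps2 (pi p))].

Definition integrability_data (R : realType) (M : manifold R 3)
    (e1 e2 e3 : vfield M) (f1 f2 k1 k2 s : cinf M) : Prop :=
  forall p : M,
    [/\ bracket e1 e3 p = k1 p *: e3 p,
        bracket e2 e3 p = k2 p *: e3 p
      & bracket e1 e2 p = f1 p *: e1 p + f2 p *: e2 p - (2%:R * s p) *: e3 p].

(* Main.v *)
(* Write [P1 = eps1 o pi], [P2 = eps2 o pi].  The curvature of the horizontal plane
   in [M] differs from that of its image by the O'Neill term [3 sigma^2]; both
   equal [c], so [sigma = 0].  The remaining sectional curvatures, together with
   the Jacobi identity for [e1, e2, e3], then give [f1 = 0], [e2 kappa1 = 0] and
   [kappa1 f2 = - c].  The tension field is [- kappa1 P1], and since the
   f-bitension field is the Jacobi operator applied to [f] times the tension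
   field, it is
     (- Delta (f kappa1) + f kappa1 (- c + f2^2)) P1 - 2 c (e2 f) P2
   with [f2^2 = c^2 / kappa1^2].  For [f = 1] the second component vanishes. *)
Require Import Defs.
From mathcomp Require Import all_boot all_order all_algebra.
From mathcomp Require Import all_classical all_reals all_analysis.
From mathcomp Require Import ring lra.

Import Order.TTheory GRing.Theory Num.Theory.
Local Open Scope ring_scope.

(** * Pointwise calculus of tangent vectors, sections and connections *)

Lemma linear_sum_scale (R : pzRingType) (U W : lmodType R) (F : U -> W)
    (I : Type) (r : seq I) (a : I -> R) (v : I -> U) :
  (forall (b : R) (x y : U), F (b *: x + y) = b *: F x + F y) ->
  F (\sum_(i <- r) a i *: v i) = \sum_(i <- r) a i *: F (v i).
Proof.
move=> lF; elim: r => [|i r IH]; last by rewrite !big_cons lF IH.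
(* The instance [b = -1], [x = y = 0] of linearity forces [F 0 = 0]. *)
by rewrite !big_nil; have := lF (-1) 0 0; rewrite scaleN1r oppr0 addr0 scaleN1r addNr.
Qed.

Section Sections.
Set Implicit Arguments.
Unset Strict Implicit.
Variables (R : realType) (m n : nat) (M : manifold R m) (N : manifold R n).

Lemma tangent_ext (p : M) (v w : tangent p) : (forall u, v u = w u) -> v = w.
Proof. by move=> vw; apply: val_inj; apply/funext. Qed.

Lemma tangent_addE (p : M) (v w : tangent p) u : (v + w) u = v u + w u.
Proof. by []. Qed.

Lemma tangent_oppE (p : M) (v : tangent p) u : (- v) u = - v u.
Proof. by []. Qed.

Lemma tangent_scaleE (p : M) a (v : tangent p) u : (a *: v) u = a * v u.
Proof. by []. Qed.

Lemma tangent_zeroE (p : M) u : (0 : tangent p) u = 0.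
Proof. by []. Qed.

Lemma cinf_addE (u w : cinf M) p : (u + w) p = u p + w p.
Proof. by []. Qed.

Lemma cinf_oppE (u : cinf M) p : (- u) p = - u p.
Proof. by []. Qed.

Lemma cinf_mulE (u w : cinf M) p : (u * w) p = u p * w p.
Proof. by []. Qed.

Lemma section_appE (phi : M -> N) (V : section phi) u p :
  section_app V u p = V p u.
Proof. by []. Qed.

Lemma sectionDE (phi : M -> N) (V W : section phi) p :
  sectionD V W p = V p + W p.
Proof. by []. Qed.

Lemma sectionME (phi : M -> N) (a : cinf M) (V : section phi) p :
  sectionM a V p = a p *: V p.
Proof. by []. Qed.

Lemma section0E (phi : M -> N) p : section0 phi p = 0.
Proof. by []. Qed.

Lemma tangentD (p : M) (v : tangent p) (u w : cinf M) : v (u + w) = v u + v w.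
Proof. by have := tangent_linear v 1 u w; rewrite scale1r mul1r. Qed.

Lemma tangent0 (p : M) (v : tangent p) : v 0 = 0.
Proof. by apply: (addrI (v 0)); rewrite -tangentD !addr0. Qed.

Lemma tangentN (p : M) (v : tangent p) (u : cinf M) : v (- u) = - v u.
Proof. by apply/eqP; rewrite -addr_eq0 -tangentD addNr tangent0. Qed.

(** The Leibniz rule on [1 = 1 * 1] gives [v 1 = v 1 + v 1], so a derivation kills [1], and then
    every constant by linearity. *)
Lemma tangent_cst (p : M) (v : tangent p) (u : cinf M) (a : R) :
  (forall q, u q = a) -> v u = 0.
Proof.
move=> ua; have -> : u = a *: (1 : cinf M) by apply/val_inj/funext => q /=; rewrite ua mulr1.
have v1 : v 1 = 0.
  have := tangent_leibniz v 1 1; rewrite mulr1 /= mul1r => /eqP.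
  by rewrite eq_sym -subr_eq0 addrK => /eqP.
by have := tangent_linear v a 1 0; rewrite tangent0 !addr0 v1 mulr0.
Qed.

Lemma section_ext (phi : M -> N) (V W : section phi) :
  (forall p, V p = W p) -> V = W.
Proof.
case: V W => [V sV] [W sW] /= VW.
have {}VW : V = W by apply: functional_extensionality_dep.
by subst W; congr Section; exact: Prop_irrelevance.
Qed.

(** A section is determined by its values, so once a smooth [W] exists it is the only candidate for
    the [xget] in [to_section]. *)
Lemma to_sectionE (phi : M -> N) (V : forall p, tangent (phi p))
    (W : section phi) : (forall p, V p = W p) -> to_section V = W.
Proof.
move=> VW; apply: section_ext => p; rewrite /to_section.
case: xgetP => [X _ /(_ p) ->|/(_ W)[]//] //.
Qed.

Variables (phi : M -> N) (D : connection phi).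

Lemma cov0r (p : M) (v : tangent p) (V : section phi) :
  (forall q, V q = 0) -> D p v V = 0.
Proof.
move=> V0; apply: (addrI (D p v V)); rewrite -covD addr0; congr (D p v _).
by apply: section_ext => q /=; rewrite V0 addr0.
Qed.

Lemma cov0l (p : M) (V : section phi) : D p 0 V = 0.
Proof.
by have := cov_linear D (-1) (0 : tangent p) 0 V; rewrite scaler0 addr0 scaleN1r addNr.
Qed.

Lemma cov_sectionE (X : vfield M) (V : section phi) p :
  cov_section D X V p = D p (X p) V.
Proof. by []. Qed.

Lemma covDl (p : M) (v w : tangent p) (V : section phi) :
  D p (v + w) V = D p v V + D p w V.
Proof. by have := cov_linear D 1 v w V; rewrite !scale1r. Qed.

Lemma covZl (p : M) (a : R) (v : tangent p) (V : section phi) :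
  D p (a *: v) V = a *: D p v V.
Proof. by have := cov_linear D a v 0 V; rewrite !addr0 cov0l addr0. Qed.

Lemma covNl (p : M) (v : tangent p) (V : section phi) :
  D p (- v) V = - D p v V.
Proof. by rewrite -scaleN1r covZl scaleN1r. Qed.

End Sections.

(* Evaluates everything at a point and on a test function, so that identities
   between tangent vectors become ring identities. *)
Definition pointE := (sectionDE, sectionME, section0E, tangent_addE,
  tangent_oppE, tangent_scaleE, tangent_zeroE, section_appE, cinf_addE,
  cinf_oppE, cinf_mulE).

(** * Orthonormal frames: traces, tensoriality, gradient and Laplacian *)

Section Frames.
Set Implicit Arguments.
Unset Strict Implicit.
Variables (R : realType) (n : nat) (M : manifold R n) (g : metric M).

Lemma metricZDr (p : M) a (u v w : tangent p) :
  g p w (a *: u + v) = a * g p w u + g p w v.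
Proof. by rewrite Defs.metric_sym metric_linear ![g p _ w]Defs.metric_sym. Qed.

Lemma metric0l (p : M) (w : tangent p) : g p 0 w = 0.
Proof.
by have := metric_linear g (-1) (0 : tangent p) 0 w; rewrite scaler0 addr0 mulN1r addNr.
Qed.

Lemma metricDl (p : M) (u v w : tangent p) : g p (u + v) w = g p u w + g p v w.
Proof. by have := metric_linear g 1 u v w; rewrite scale1r mul1r. Qed.

Lemma metricZl (p : M) a (u w : tangent p) : g p (a *: u) w = a * g p u w.
Proof. by have := metric_linear g a u 0 w; rewrite !addr0 metric0l addr0. Qed.

Lemma metricNl (p : M) (u w : tangent p) : g p (- u) w = - g p u w.
Proof. by rewrite -scaleN1r metricZl mulN1r. Qed.

Lemma metricDr (p : M) (u v w : tangent p) : g p w (u + v) = g p w u + g p w v.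
Proof. by rewrite ![g p w _]Defs.metric_sym metricDl. Qed.

Lemma metricZr (p : M) a (u w : tangent p) : g p w (a *: u) = a * g p w u.
Proof. by rewrite ![g p w _]Defs.metric_sym metricZl. Qed.

Lemma orthonormal_coord (p : M) (b : 'I_n -> tangent p) (v : tangent p) :
  orthonormal_basis g b -> v = \sum_i g p v (b i) *: b i.
Proof.
move=> [on /(_ v)[a ->]]; apply: eq_bigr => i _; congr (_ *: _).
rewrite (linear_sum_scale _ _ (R^o) (fun x => g p x (b i))); last first.
  by move=> *; exact: metric_linear.
rewrite (bigD1 i) //= on eqxx big1 ?addr0 => [|j /negPf ji].
  by rewrite /GRing.scale /= mulr1.
by rewrite on ji scaler0.
Qed.

(** Basis independence of the trace: the basis [d] chosen in [trace_g] and the given [b] differ by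
    an orthogonal matrix [A], and expanding the bilinear [B] leaves the coefficients of
    [A^T *m A = 1]. *)
Lemma trace_gE (p : M) (W : lmodType R) (B : tangent p -> tangent p -> W)
    (b : 'I_n -> tangent p) :
  orthonormal_basis g b ->
  (forall a v v' w, B (a *: v + v') w = a *: B v w + B v' w) ->
  (forall a v w w', B v (a *: w + w') = a *: B v w + B v w') ->
  trace_g g B = \sum_i B (b i) (b i).
Proof.
move=> onb Bl Br; rewrite /trace_g; set d := xget _ _.
have ond : orthonormal_basis g d by apply: (xgetPex _ (ex_intro _ b onb)).
pose A : 'M[R]_n := \matrix_(j, i) g p (d j) (b i).
have dE j : d j = \sum_i A j i *: b i.
  by rewrite {1}(orthonormal_coord (d j) onb); apply: eq_bigr => i _; rewrite mxE.
have AtA : A^T *m A = 1%:M.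
  (* Orthonormality of [d] gives [A *m A^T = 1]; for square matrices a right inverse is a left
     inverse. *)
  apply: mulmx1C; apply/matrixP => j k; rewrite !mxE -(proj1 ond j k).
  rewrite (dE k) (linear_sum_scale _ _ (R^o) (g p (d j))); last first.
    by move=> *; exact: metricZDr.
  by apply: eq_bigr => i _; rewrite !mxE /GRing.scale /= mulrC.
have BE j : B (d j) (d j) = \sum_i \sum_k (A j i * A j k) *: B (b i) (b k).
  rewrite {1}dE (linear_sum_scale _ _ _ (B^~ (d j))); last by move=> *; exact: Bl.
  apply: eq_bigr => i _; rewrite dE linear_sum_scale // scaler_sumr.
  by apply: eq_bigr => k _; rewrite scalerA.
under eq_bigr do rewrite BE.
rewrite exchange_big /=; apply: eq_bigr => i _.
rewrite exchange_big /=.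
under eq_bigr => k _ do rewrite -scaler_suml.
have AE k : \sum_j A j i * A j k = (i == k)%:R.
  have := congr1 (fun X : 'M[R]_n => X i k) AtA; rewrite !mxE => <-.
  by apply: eq_bigr => j _; rewrite !mxE.
under eq_bigr => k _ do rewrite AE.
rewrite (bigD1 i) //= eqxx scale1r big1 ?addr0 // => k /negPf ki.
by rewrite eq_sym ki scale0r.
Qed.

Variables (E : 'I_n -> vfield M) (onE : orthonormal_frame g E).

Definition sum_section (F : 'I_n -> vfield M) (r : seq 'I_n) : vfield M :=
  \big[@sectionD _ _ _ M M id/section0 _]_(i <- r) F i.

Lemma sum_sectionE F r p : sum_section F r p = \sum_(i <- r) F i p.
Proof.
rewrite /sum_section; elim: r => [|i r IH]; first by rewrite !big_nil.
by rewrite !big_cons /= IH.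
Qed.

Lemma frame_expansion (Y : vfield M) :
  Y = sum_section (fun i => sectionM (metric_app g Y (E i)) (E i)) (index_enum _).
Proof.
apply: section_ext => p; rewrite sum_sectionE.
exact: (orthonormal_coord (Y p) (onE p)).
Qed.

(* Everything expands in the global frame, so C^oo-linearity alone gives
   dependence on the value at p; no cut-off functions are needed. *)
Lemma tensorial (W : lmodType R) (p : M) (T : vfield M -> W) (Y Y' : vfield M) :
  (forall X X', T (sectionD X X') = T X + T X') ->
  (forall (a : cinf M) X, T (sectionM a X) = a p *: T X) ->
  Y p = Y' p -> T Y = T Y'.
Proof.
move=> TD TM YY'.
have T0 : T (section0 _) = 0.
  apply: (addrI (T (section0 _))); rewrite -TD addr0; congr T.
  by apply: section_ext => q /=; rewrite addr0.
have TE X : T X = \sum_i g p (X p) (E i p) *: T (E i).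
  rewrite {1}(frame_expansion X) /sum_section (big_morph T TD T0).
  by apply: eq_bigr => i _; rewrite TM.
by rewrite !TE YY'.
Qed.

(** The combination of the global frame whose coefficients are the constants [g p v (E i p)] extends
    [v], so [extend] does not fall back on its default. *)
Lemma extendE (p : M) (v : tangent p) : extend v p = v.
Proof.
rewrite /extend; apply: (xgetPex _ (P := [set X : vfield M | X p = v]%classic)).
pose a i := g p v (E i p) *: (1 : cinf M).
exists (sum_section (fun i => sectionM (a i) (E i)) (index_enum _)).
rewrite /= sum_sectionE [RHS](orthonormal_coord v (onE p)).
by apply: eq_bigr => i _ /=; rewrite mulr1.
Qed.

Lemma tensorial_extend (W : lmodType R) (p : M) (T : vfield M -> W) (Y : vfield M) :
  (forall X X', T (sectionD X X') = T X + T X') ->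
  (forall (a : cinf M) X, T (sectionM a X) = a p *: T X) ->
  T (extend (Y p)) = T Y.
Proof. by move=> TD TM; apply: tensorial => //; rewrite extendE. Qed.

(** The choice made by [extend] need not be linear in the vector; tensoriality of [T] makes the
    composite linear all the same. *)
Lemma tensorial_extend_linear (W : lmodType R) (p : M) (T : vfield M -> W) :
  (forall X X', T (sectionD X X') = T X + T X') ->
  (forall (a : cinf M) X, T (sectionM a X) = a p *: T X) ->
  forall (a : R) (v w : tangent p),
    T (extend (a *: v + w)) = a *: T (extend v) + T (extend w).
Proof.
move=> TD TM a v w.
(* The scalar is read as the value at [p] of a constant function, so that linearity over smooth
   functions applies. *)
have -> : a = (a *: (1 : cinf M)) p by rewrite /= mulr1.
rewrite -TM -TD; apply: tensorial => //=.
by rewrite !extendE.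
Qed.

(** The field [sum_i E_i(u) E_i] has the defining property of the gradient, so the set searched by
    [grad] is nonempty. *)
Lemma gradE (u : cinf M) p (v : tangent p) : g p (grad g u p) v = v u.
Proof.
rewrite /grad; apply: (xgetPex _ (P := [set G : vfield M |
  forall p (v : tangent p), g p (G p) v = v u]%classic)).
exists (sum_section (fun i => sectionM (section_app (E i) u) (E i)) (index_enum _)).
move=> q w /=; rewrite sum_sectionE /=.
rewrite (linear_sum_scale _ _ (R^o) (fun x => g q x w)); last first.
  by move=> *; exact: metric_linear.
rewrite {2}(orthonormal_coord w (onE q)).
rewrite (linear_sum_scale _ _ (R^o) (fun x : tangent q => x u)) //.
by apply: eq_bigr => i _; rewrite /GRing.scale /= mulrC Defs.metric_sym.
Qed.

Lemma grad_frame (u : cinf M) p : grad g u p = \sum_i E i p u *: E i p.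
Proof.
rewrite [LHS](orthonormal_coord _ (onE p)); apply: eq_bigr => i _.
by rewrite gradE.
Qed.

(** Metric compatibility turns [g(D_{E_i} grad u, E_i)] into [E_i(g(grad u, E_i)) - g(grad u,
    D_{E_i} E_i)], and both inner products with the gradient are derivatives of [u]. *)
Lemma laplacian_frame (DM : affine_connection M) (u : cinf M) p :
  levi_civita g DM ->
  laplacian g DM u p =
  \sum_i (E i p (section_app (E i) u) - DM p (E i p) (E i) u).
Proof.
move=> [_ compat]; rewrite /laplacian /divergence.
rewrite (@trace_gE p (R^o) _ (fun i => E i p)) //=; first last.
- by move=> a v w w'; rewrite metricZDr.
- by move=> a v v' w; rewrite cov_linear metric_linear.
apply: eq_bigr => i _.
have -> : section_app (E i) u = metric_app g (grad g u) (E i).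
  by apply/val_inj/funext => q /=; rewrite gradE.
by rewrite compat gradE addrK.
Qed.

Lemma laplacianM (DM : affine_connection M) (u w : cinf M) p :
  levi_civita g DM ->
  laplacian g DM (u * w) p = u p * laplacian g DM w p + w p * laplacian g DM u p
    + 2%:R * \sum_i E i p u * E i p w.
Proof.
move=> lc; rewrite !laplacian_frame // !mulr_sumr -!big_split /=.
apply: eq_bigr => i _; rewrite section_app_leibniz tangentD !tangent_leibniz /=.
by ring.
Qed.

End Frames.

(** * Brackets, the curvature tensor, and Koszul's formula on a frame *)

Section Curvature.
Set Implicit Arguments.
Unset Strict Implicit.
Variables (R : realType) (n : nat) (M : manifold R n) (g : metric M).
Variable (D : affine_connection M).

Lemma bracketE (X Y : vfield M) p u :
  bracket X Y p u = X p (section_app Y u) - Y p (section_app X u).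
Proof. by []. Qed.

Lemma bracket_anti (X Y : vfield M) p : bracket Y X p = - bracket X Y p.
Proof. by apply: tangent_ext => u; rewrite pointE !bracketE opprB. Qed.

Lemma bracket_self (X : vfield M) p : bracket X X p = 0.
Proof. by apply: tangent_ext => u; rewrite bracketE subrr. Qed.

Lemma bracketMr (a : cinf M) (X Y : vfield M) p :
  bracket X (sectionM a Y) p = X p a *: Y p + a p *: bracket X Y p.
Proof.
apply: tangent_ext => u; rewrite !(pointE, bracketE).
have -> : section_app (sectionM a Y) u = a * section_app Y u by exact: val_inj.
by rewrite tangent_leibniz !pointE; ring.
Qed.

Lemma bracket0r (X : vfield M) p : bracket X (section0 _) p = 0.
Proof.
have -> : section0 _ = sectionM 0 X by apply: section_ext => q; rewrite !pointE scale0r.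
by rewrite bracketMr tangent0 !scale0r addr0.
Qed.

Lemma bracketDr (X Y Z : vfield M) p :
  bracket X (sectionD Y Z) p = bracket X Y p + bracket X Z p.
Proof.
apply: tangent_ext => u; rewrite !(pointE, bracketE).
have -> : section_app (sectionD Y Z) u = section_app Y u + section_app Z u.
  exact: val_inj.
by rewrite tangentD; ring.
Qed.

Lemma jacobi (X Y Z : vfield M) p :
  bracket X (bracket Y Z) p + bracket Y (bracket Z X) p
  + bracket Z (bracket X Y) p = 0.
Proof.
apply: tangent_ext => u; rewrite !(pointE, bracketE).
have bE A B : section_app (bracket A B) u =
    section_app A (section_app B u) - section_app B (section_app A u).
  exact: val_inj.
by rewrite !(bE, bracketE, tangentD, tangentN, pointE); ring.
Qed.

(** The curvature expression for fields, before any choice of extensions. Tensoriality is checked on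
    it slot by slot and carried over to [curvature] by [curvatureE]. *)
Definition curv_field (X Y Z : vfield M) (p : M) : tangent p :=
  D p (X p) (cov_section D Y Z) - D p (Y p) (cov_section D X Z)
  - D p (bracket X Y p) Z.

Lemma curv_field_anti X Y Z p : curv_field Y X Z p = - curv_field X Y Z p.
Proof.
by rewrite /curv_field bracket_anti covNl; apply: tangent_ext => u; rewrite !pointE; ring.
Qed.

Lemma curv_field_self X Z p : curv_field X X Z p = 0.
Proof. by rewrite /curv_field subrr bracket_self cov0l subr0. Qed.

Lemma curv_fieldDl X X' Y Z p :
  curv_field (sectionD X X') Y Z p = curv_field X Y Z p + curv_field X' Y Z p.
Proof.
rewrite /curv_field sectionDE covDl.
have -> : cov_section D (sectionD X X') Z =
    sectionD (cov_section D X Z) (cov_section D X' Z).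
  by apply: section_ext => q /=; rewrite covDl.
rewrite covD bracket_anti bracketDr covNl covDl [bracket X _ p]bracket_anti.
rewrite [bracket X' _ p]bracket_anti !covNl.
by apply: tangent_ext => u; rewrite !pointE; ring.
Qed.

(** The term [Y(a) D_X Z] from differentiating [a D_X Z] along [Y] cancels against the one from
    [[a X, Y] = a [X, Y] - Y(a) X]. *)
Lemma curv_fieldMl (a : cinf M) X Y Z p :
  curv_field (sectionM a X) Y Z p = a p *: curv_field X Y Z p.
Proof.
rewrite /curv_field sectionME covZl.
have -> : cov_section D (sectionM a X) Z = sectionM a (cov_section D X Z).
  by apply: section_ext => q /=; rewrite covZl.
rewrite cov_leibniz bracket_anti bracketMr covNl covDl !covZl.
rewrite [bracket X _ p]bracket_anti !covNl.
by apply: tangent_ext => u; rewrite !pointE; ring.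
Qed.

Lemma curv_fieldDr X Y Z Z' p :
  curv_field X Y (sectionD Z Z') p = curv_field X Y Z p + curv_field X Y Z' p.
Proof.
rewrite /curv_field.
have cE A : cov_section D A (sectionD Z Z') =
    sectionD (cov_section D A Z) (cov_section D A Z').
  by apply: section_ext => q /=; rewrite covD.
rewrite !cE !covD.
by apply: tangent_ext => u; rewrite !pointE; ring.
Qed.

(** The first-order cross terms cancel by antisymmetry in [X], [Y], and the second derivatives
    [X(Y a) - Y(X a)] cancel against [[X, Y] a]. *)
Lemma curv_fieldMr (a : cinf M) X Y Z p :
  curv_field X Y (sectionM a Z) p = a p *: curv_field X Y Z p.
Proof.
rewrite /curv_field.
have cE A : cov_section D A (sectionM a Z) =
    sectionD (sectionM (section_app A a) Z) (sectionM a (cov_section D A Z)).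
  by apply: section_ext => q /=; rewrite cov_leibniz.
rewrite !cE !covD !cov_leibniz.
by apply: tangent_ext => u; rewrite !(pointE, bracketE); ring.
Qed.

Lemma curv_fieldDm X Y Y' Z p :
  curv_field X (sectionD Y Y') Z p = curv_field X Y Z p + curv_field X Y' Z p.
Proof.
by rewrite curv_field_anti curv_fieldDl opprD -!(curv_field_anti _ X).
Qed.

Lemma curv_fieldMm (a : cinf M) X Y Z p :
  curv_field X (sectionM a Y) Z p = a p *: curv_field X Y Z p.
Proof. by rewrite curv_field_anti curv_fieldMl -scalerN -curv_field_anti. Qed.

Variables (E : 'I_n -> vfield M) (onE : orthonormal_frame g E).

Lemma curvature_extend p (x y z : tangent p) :
  curvature D x y z = curv_field (extend x) (extend y) (extend z) p.
Proof. by rewrite /curvature /curv_field !(extendE onE). Qed.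

(** The extensions chosen in [curvature] are exchanged for the given fields one slot at a time;
    afterwards curvature can be computed from the structure functions of a frame. *)
Lemma curvatureE (X Y Z : vfield M) p :
  curvature D (X p) (Y p) (Z p) = curv_field X Y Z p.
Proof.
rewrite curvature_extend.
rewrite (tensorial_extend onE (T := fun A => curv_field _ _ A p));
  [|by move=> *; exact: curv_fieldDr|by move=> *; exact: curv_fieldMr].
rewrite (tensorial_extend onE (T := fun A => curv_field _ A _ p));
  [|by move=> *; exact: curv_fieldDm|by move=> *; exact: curv_fieldMm].
rewrite (tensorial_extend onE (T := fun A => curv_field A _ _ p)) //.
- by move=> *; exact: curv_fieldDl.
- by move=> *; exact: curv_fieldMl.
Qed.

Lemma curvature_linear1 p a (x x' y z : tangent p) :
  curvature D (a *: x + x') y z = a *: curvature D x y z + curvature D x' y z.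
Proof.
rewrite !curvature_extend.
apply: (tensorial_extend_linear onE (T := fun A => curv_field A _ _ p)).
- by move=> *; exact: curv_fieldDl.
- by move=> *; exact: curv_fieldMl.
Qed.

Lemma curvature_linear3 p a (x y z z' : tangent p) :
  curvature D x y (a *: z + z') = a *: curvature D x y z + curvature D x y z'.
Proof.
rewrite !curvature_extend.
apply: (tensorial_extend_linear onE (T := fun A => curv_field _ _ A p)).
- by move=> *; exact: curv_fieldDr.
- by move=> *; exact: curv_fieldMr.
Qed.

Lemma frame_cst (i j : 'I_n) (p : M) (v : tangent p) :
  v (metric_app g (E i) (E j)) = 0.
Proof.
by apply: (@tangent_cst _ _ _ _ _ _ (i == j)%:R) => q; exact: (proj1 (onE q) i j).
Qed.

(* Koszul's formula; the derivatives of the inner products vanish on a frame. *)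
Lemma koszul_frame (X Y Z : vfield M) (p : M) :
  levi_civita g D ->
  (exists i, X = E i) -> (exists i, Y = E i) -> (exists i, Z = E i) ->
  2%:R * g p (D p (X p) Y) (Z p) =
    g p (bracket X Y p) (Z p) - g p (bracket Y Z p) (X p)
    + g p (bracket Z X p) (Y p).
Proof.
move=> [tor compat] [i ->] [j ->] [k ->].
have eqs a b d := etrans (esym (compat (E a) (E b) (E d) p)) (frame_cst b d (E a p)).
rewrite -!tor !metricDl !metricNl.
have := eqs i j k; have := eqs j k i; have := eqs k i j.
rewrite ![g p (E i p) _]Defs.metric_sym ![g p (E j p) _]Defs.metric_sym.
rewrite ![g p (E k p) _]Defs.metric_sym.
by lra.
Qed.

(** The squared length [a] of [x] is left free because a polarization later uses a vector of squared
    length 2. Being nonzero, it is a legitimate denominator and makes [x], [y] independent. *)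
Lemma constant_curvature_orthogonal (c : R) (p : M) (x y : tangent p) (a : R) :
  constant_curvature g D c -> a != 0 ->
  g p x x = a -> g p y y = 1 -> g p x y = 0 ->
  g p (curvature D x y y) x = c * a.
Proof.
move=> cc a0 gx gy gxy; have := cc p x y.
rewrite /sectional_curvature gx gy gxy expr0n subr0 mulr1 => <-.
  by rewrite divfK.
move=> r s rs; split.
  have /eqP := congr1 (fun v => g p v x) rs.
  rewrite metricDl !metricZl metric0l gx Defs.metric_sym gxy.
  by rewrite mulr0 addr0 mulf_eq0 (negPf a0) orbF => /eqP.
have /eqP := congr1 (fun v => g p v y) rs.
by rewrite metricDl !metricZl metric0l gxy gy mulr0 add0r mulr1 => /eqP.
Qed.

End Curvature.

Lemma sum_tnth2 (V : nmodType) (T : Type) (F : T -> V) (x y : T) :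
  \sum_(i < 2) F (tnth [tuple x; y] i) = F x + F y.
Proof.
rewrite -(big_tuple _ _ [tuple x; y] xpredT F) /=.
by rewrite !big_cons big_nil addr0.
Qed.

Lemma sum_tnth3 (V : nmodType) (T : Type) (F : T -> V) (x y z : T) :
  \sum_(i < 3) F (tnth [tuple x; y; z] i) = F x + F y + F z.
Proof.
rewrite -(big_tuple _ _ [tuple x; y; z] xpredT F) /=.
by rewrite !big_cons big_nil addr0 addrA.
Qed.

(** * The base surface: Levi-Civita connection and Gauss curvature in a frame *)

Section Surface.
Set Implicit Arguments.
Unset Strict Implicit.
Variables (R : realType) (N : manifold R 2) (h : metric N).
Variable (DN : affine_connection N).
Variables (eps1 eps2 : vfield N).
Hypothesis lcN : levi_civita h DN.
Hypothesis onN : orthonormal_frame h (tnth [tuple eps1; eps2]).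

Let frameN1 : exists i, eps1 = tnth [tuple eps1; eps2] i :=
  ex_intro _ (@Ordinal 2 0 isT) erefl.
Let frameN2 : exists i, eps2 = tnth [tuple eps1; eps2] i :=
  ex_intro _ (@Ordinal 2 1 isT) erefl.

Lemma surface_gram q :
  ((h q (eps1 q) (eps1 q) = 1) * (h q (eps2 q) (eps2 q) = 1)
  * (h q (eps1 q) (eps2 q) = 0) * (h q (eps2 q) (eps1 q) = 0))%type.
Proof.
have G i j := proj1 (onN q) i j.
do !split; [exact: (G (@Ordinal 2 0 isT) (@Ordinal 2 0 isT))
  |exact: (G (@Ordinal 2 1 isT) (@Ordinal 2 1 isT))
  |exact: (G (@Ordinal 2 0 isT) (@Ordinal 2 1 isT))
  |exact: (G (@Ordinal 2 1 isT) (@Ordinal 2 0 isT))].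
Qed.

Let hE := (metricDl, metricNl, metricZl, metric0l, surface_gram).

Lemma surface_coord q (v : tangent q) :
  v = h q v (eps1 q) *: eps1 q + h q v (eps2 q) *: eps2 q.
Proof.
rewrite {1}(orthonormal_coord v (onN q)).
by rewrite [LHS](sum_tnth2 (fun X : vfield N => h q v (X q) *: X q)).
Qed.

Lemma surface_ext q (v w : tangent q) :
  h q v (eps1 q) = h q w (eps1 q) -> h q v (eps2 q) = h q w (eps2 q) -> v = w.
Proof. by move=> e1 e2; rewrite [LHS]surface_coord [RHS]surface_coord e1 e2. Qed.

Variables (F1 F2 : cinf N).
Hypothesis brN : forall q, bracket eps1 eps2 q = F1 q *: eps1 q + F2 q *: eps2 q.

Let br21 q : bracket eps2 eps1 q = - (F1 q *: eps1 q + F2 q *: eps2 q).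
Proof. by rewrite bracket_anti brN. Qed.

(** A vector is fixed by its two frame components, and Koszul's formula gives twice each component
    in terms of the bracket. *)
Lemma surface_cov q :
  [/\ DN q (eps1 q) eps1 = - F1 q *: eps2 q, DN q (eps1 q) eps2 = F1 q *: eps1 q,
      DN q (eps2 q) eps1 = - F2 q *: eps2 q & DN q (eps2 q) eps2 = F2 q *: eps1 q].
Proof.
have K X Y Z fX fY fZ := @koszul_frame _ _ _ _ _ _ onN X Y Z q lcN fX fY fZ.
have := (frameN1, frameN2) => -[f1 f2].
split; apply: surface_ext.
- by have := K _ _ _ f1 f1 f1; rewrite !(bracket_self, brN, br21) !hE; lra.
- by have := K _ _ _ f1 f1 f2; rewrite !(bracket_self, brN, br21) !hE; lra.
- by have := K _ _ _ f1 f2 f1; rewrite !(bracket_self, brN, br21) !hE; lra.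
- by have := K _ _ _ f1 f2 f2; rewrite !(bracket_self, brN, br21) !hE; lra.
- by have := K _ _ _ f2 f1 f1; rewrite !(bracket_self, brN, br21) !hE; lra.
- by have := K _ _ _ f2 f1 f2; rewrite !(bracket_self, brN, br21) !hE; lra.
- by have := K _ _ _ f2 f2 f1; rewrite !(bracket_self, brN, br21) !hE; lra.
- by have := K _ _ _ f2 f2 f2; rewrite !(bracket_self, brN, br21) !hE; lra.
Qed.

(** The coefficient is the Gauss curvature written in the structure functions [F1], [F2] of the
    frame. *)
Lemma gauss_curvature_field q :
  curv_field DN eps1 eps2 eps2 q =
  (eps1 q F2 - eps2 q F1 - F1 q ^+ 2 - F2 q ^+ 2) *: eps1 q.
Proof.
have cs12 : cov_section DN eps1 eps2 = sectionM F1 eps1.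
  by apply: section_ext => r /=; have [] := surface_cov r.
have cs22 : cov_section DN eps2 eps2 = sectionM F2 eps1.
  by apply: section_ext => r /=; have [] := surface_cov r.
rewrite /curv_field cs12 cs22 brN covDl !covZl !cov_leibniz.
have [-> -> -> ->] := surface_cov q.
by apply: tangent_ext => u; rewrite !pointE; ring.
Qed.

Lemma gauss_curvature (c : R) q :
  constant_curvature h DN c ->
  eps1 q F2 - eps2 q F1 - F1 q ^+ 2 - F2 q ^+ 2 = c.
Proof.
move=> /constant_curvature_orthogonal cc.
have := cc q (eps1 q) (eps2 q) 1 (oner_neq0 _) .
rewrite !surface_gram mulr1 => /(_ erefl erefl erefl) <-.
by rewrite (curvatureE _ onN) gauss_curvature_field !hE mulr1.
Qed.

End Surface.

(** * The total space: connection, sectional curvatures and the Jacobi identity *)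

Section Threefold.
Set Implicit Arguments.
Unset Strict Implicit.
Variables (R : realType) (M : manifold R 3) (g : metric M).
Variable (DM : affine_connection M).
Variables (e1 e2 e3 : vfield M) (f1 f2 kappa1 kappa2 sigma : cinf M).
Hypothesis lcM : levi_civita g DM.
Hypothesis onM : orthonormal_frame g (tnth [tuple e1; e2; e3]).
Hypothesis idata : integrability_data e1 e2 e3 f1 f2 kappa1 kappa2 sigma.
Hypothesis kappa2_0 : forall p, kappa2 p = 0.

Let i0 := @Ordinal 3 0 isT.
Let i1 := @Ordinal 3 1 isT.
Let i2 := @Ordinal 3 2 isT.

Let frame1 : exists i, e1 = tnth [tuple e1; e2; e3] i := ex_intro _ i0 erefl.
Let frame2 : exists i, e2 = tnth [tuple e1; e2; e3] i := ex_intro _ i1 erefl.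
Let frame3 : exists i, e3 = tnth [tuple e1; e2; e3] i := ex_intro _ i2 erefl.

Lemma frame_gram p :
  ((g p (e1 p) (e1 p) = 1) * (g p (e2 p) (e2 p) = 1) * (g p (e3 p) (e3 p) = 1)
  * (g p (e1 p) (e2 p) = 0) * (g p (e2 p) (e1 p) = 0) * (g p (e1 p) (e3 p) = 0)
  * (g p (e3 p) (e1 p) = 0) * (g p (e2 p) (e3 p) = 0) * (g p (e3 p) (e2 p) = 0))%type.
Proof.
have G i j := proj1 (onM p) i j.
do !split; [exact: (G i0 i0)|exact: (G i1 i1)|exact: (G i2 i2)|exact: (G i0 i1)
  |exact: (G i1 i0)|exact: (G i0 i2)|exact: (G i2 i0)|exact: (G i1 i2)|exact: (G i2 i1)].
Qed.

Let gE := (@metricDl _ _ _ g, @metricNl _ _ _ g, @metricZl _ _ _ g,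
  @metricDr _ _ _ g, @metricZr _ _ _ g, @metric0l _ _ _ g, frame_gram).

Lemma frame_ext p (v w : tangent p) :
  g p v (e1 p) = g p w (e1 p) -> g p v (e2 p) = g p w (e2 p) ->
  g p v (e3 p) = g p w (e3 p) -> v = w.
Proof.
have coord x : x = g p x (e1 p) *: e1 p + g p x (e2 p) *: e2 p + g p x (e3 p) *: e3 p.
  rewrite {1}(orthonormal_coord x (onM p)).
  by rewrite [LHS](sum_tnth3 (fun X : vfield M => g p x (X p) *: X p)).
by move=> E1 E2 E3; rewrite [LHS]coord [RHS]coord E1 E2 E3.
Qed.

Let br12 p : bracket e1 e2 p = f1 p *: e1 p + f2 p *: e2 p - (2%:R * sigma p) *: e3 p.
Proof. by have [_ _ ->] := idata p. Qed.
Let br13 p : bracket e1 e3 p = kappa1 p *: e3 p.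
Proof. by have [-> _ _] := idata p. Qed.
Let br23 p : bracket e2 e3 p = 0.
Proof. by have [_ -> _] := idata p; rewrite kappa2_0 scale0r. Qed.
Let br21 p : bracket e2 e1 p = - (f1 p *: e1 p + f2 p *: e2 p - (2%:R * sigma p) *: e3 p).
Proof. by rewrite bracket_anti br12. Qed.
Let br31 p : bracket e3 e1 p = - (kappa1 p *: e3 p).
Proof. by rewrite bracket_anti br13. Qed.
Let br32 p : bracket e3 e2 p = 0.
Proof. by rewrite bracket_anti br23 oppr0. Qed.

Lemma frame_cov p :
  ((DM p (e1 p) e1 = - f1 p *: e2 p) * (DM p (e1 p) e2 = f1 p *: e1 p - sigma p *: e3 p)
  * (DM p (e1 p) e3 = sigma p *: e2 p) * (DM p (e2 p) e1 = (- f2 p *: e2 p + sigma p *: e3 p)%R)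
  * (DM p (e2 p) e2 = f2 p *: e1 p) * (DM p (e2 p) e3 = - sigma p *: e1 p)
  * (DM p (e3 p) e1 = sigma p *: e2 p - kappa1 p *: e3 p)
  * (DM p (e3 p) e2 = - sigma p *: e1 p)
  * (DM p (e3 p) e3 = kappa1 p *: e1 p))%type.
Proof.
have K X Y Z fX fY fZ := @koszul_frame _ _ _ _ _ _ onM X Y Z p lcM fX fY fZ.
have brE := (br12, br13, br23, br21, br31, br32, bracket_self).
(* Koszul's formula yields doubled components, so a candidate [w] is compared after doubling and the
   factor 2 is cancelled. *)
have KK X Y w : [/\ 2%:R * g p (DM p (X p) Y) (e1 p) = 2%:R * g p w (e1 p),
    2%:R * g p (DM p (X p) Y) (e2 p) = 2%:R * g p w (e2 p) &
    2%:R * g p (DM p (X p) Y) (e3 p) = 2%:R * g p w (e3 p)] -> DM p (X p) Y = w.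
  have c2 : injective ( *%R (2%:R : R)) by apply: mulfI; rewrite pnatr_eq0.
  by move=> [/c2 E1 /c2 E2 /c2 E3]; exact: frame_ext.
by do !split; apply: KK; split; rewrite K // !(brE, gE); ring.
Qed.

(** O'Neill's formula in frame form. The terms in [f1], [f2] have the shape of the Gauss curvature
    of the base; of the three [sigma^2], one comes from [D_{e2} e3] and two from the vertical part
    of [[e1, e2]]. *)
Lemma curvature_122 p :
  g p (curv_field DM e1 e2 e2 p) (e1 p) =
  e1 p f2 - e2 p f1 - f1 p ^+ 2 - f2 p ^+ 2 - 3%:R * sigma p ^+ 2.
Proof.
have cs12 : cov_section DM e1 e2 = sectionD (sectionM f1 e1) (sectionM (- sigma) e3).
  by apply: section_ext => r /=; rewrite frame_cov scaleNr.
have cs22 : cov_section DM e2 e2 = sectionM f2 e1.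
  by apply: section_ext => r /=; rewrite frame_cov.
rewrite /curv_field cs12 cs22 br12 covD !cov_leibniz !(covDl, covNl, covZl).
by rewrite !frame_cov !gE !pointE; ring.
Qed.

Hypothesis sigma0 : forall p, sigma p = 0.
Variable c : R.
Hypothesis ccM : constant_curvature g DM c.

(** The first two equations are the sectional curvatures of the planes [(e1, e3)] and [(e2, e3)];
    the third is polarization with the plane [(e1 + e2, e3)]. *)
Lemma constant_curvature_frame p :
  [/\ e1 p kappa1 = c + kappa1 p ^+ 2, - (kappa1 p * f2 p) = c
    & e2 p kappa1 = kappa1 p * f1 p].
Proof.
have cs33 : cov_section DM e3 e3 = sectionM kappa1 e1.
  by apply: section_ext => r /=; rewrite frame_cov.
have cs13 : cov_section DM e1 e3 = section0 _.
  by apply: section_ext => r /=; rewrite frame_cov sigma0 scale0r.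
have cs23 : cov_section DM e2 e3 = section0 _.
  by apply: section_ext => r /=; rewrite frame_cov sigma0 oppr0 scale0r.
have c133 : curv_field DM e1 e3 e3 p =
    (e1 p kappa1 - kappa1 p ^+ 2) *: e1 p - (kappa1 p * f1 p) *: e2 p.
  rewrite /curv_field cs13 cs33 br13 !(covDl, covNl, covZl) cov_leibniz.
  rewrite [DM _ _ (section0 _)]cov0r // !frame_cov.
  by apply: tangent_ext => u; rewrite !pointE; ring.
have c233 : curv_field DM e2 e3 e3 p =
    e2 p kappa1 *: e1 p - (kappa1 p * f2 p) *: e2 p.
  rewrite /curv_field cs23 cs33 br23 cov0l cov_leibniz.
  rewrite [DM _ _ (section0 _)]cov0r // !frame_cov sigma0.
  by apply: tangent_ext => u; rewrite !pointE; ring.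
have sec (X : vfield M) (a : R) : a != 0 -> g p (X p) (X p) = a ->
    g p (X p) (e3 p) = 0 -> g p (curv_field DM X e3 e3 p) (X p) = c * a.
  move=> a0 Xa X3; rewrite -(curvatureE _ onM).
  by apply: constant_curvature_orthogonal => //; rewrite !gE.
have := sec e1 1 (oner_neq0 _); rewrite c133 !gE => /(_ erefl erefl) E1.
have := sec e2 1 (oner_neq0 _); rewrite c233 !gE => /(_ erefl erefl) E2.
(* As [e1 + e2] has squared length 2, the diagonal terms already account for [c * 2], and the mixed
   terms [e2 kappa1 - kappa1 f1] must vanish. *)
have := sec (sectionD e1 e2) 2%:R; rewrite pnatr_eq0 curv_fieldDl c133 c233.
rewrite !sectionDE !gE => /(_ isT) E3.
by split; lra.
Qed.

(** The [e3] component of the Jacobi identity. Its sign is opposite to that of the third equation in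
    [constant_curvature_frame], and the two together force [kappa1 f1 = 0]. *)
Lemma jacobi_frame p : e2 p kappa1 = - (kappa1 p * f1 p).
Proof.
have b23 : bracket e2 e3 = section0 _ by apply: section_ext => q; rewrite br23.
have b31 : bracket e3 e1 = sectionM (- kappa1) e3.
  by apply: section_ext => q; rewrite br31 /= scaleNr.
have b12 : bracket e1 e2 = sectionD (sectionM f1 e1) (sectionM f2 e2).
  by apply: section_ext => q; rewrite br12 sigma0 mulr0 scale0r subr0.
have := jacobi e1 e2 e3 p; rewrite b23 b31 b12 bracket0r bracketDr !bracketMr.
rewrite br23 br31 br32 tangentN => /(congr1 (fun v => g p v (e3 p))).
by rewrite !gE; lra.
Qed.

End Threefold.

(** * Maps between manifolds: related fields, and the traces of the bitension field in a frame *)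

Section Differential.
Set Implicit Arguments.
Unset Strict Implicit.
Variables (R : realType) (m n : nat) (M : manifold R m) (N : manifold R n).
Variable phi : smap M N.

Lemma differentialD p (v w : tangent p) :
  differential phi (v + w) = differential phi v + differential phi w.
Proof. exact: tangent_ext. Qed.

Lemma differentialN p (v : tangent p) : differential phi (- v) = - differential phi v.
Proof. exact: tangent_ext. Qed.

Lemma differentialZ p a (v : tangent p) :
  differential phi (a *: v) = a *: differential phi v.
Proof. exact: tangent_ext. Qed.

Lemma differential0 p : differential phi (0 : tangent p) = 0.
Proof. exact: tangent_ext. Qed.

(** Relatedness of [Z] and [C] says that [Z] applied to [u o phi] is [C u] composed with [phi];
    using this twice transports the commutator. *)
Lemma differential_bracket (X Y : vfield M) (A B : vfield N) :
  (forall p, differential phi (X p) = A (phi p)) ->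
  (forall p, differential phi (Y p) = B (phi p)) ->
  forall p, differential phi (bracket X Y p) = bracket A B (phi p).
Proof.
move=> XA YB p; apply: tangent_ext => u.
have appE (Z : vfield M) (C : vfield N) :
    (forall p, differential phi (Z p) = C (phi p)) ->
    section_app Z (pullback phi u) = pullback phi (section_app C u).
  by move=> ZC; apply/val_inj/funext => q /=; rewrite -ZC.
by rewrite /= (appE _ _ XA) (appE _ _ YB) -XA -YB.
Qed.

Lemma push_fieldD (X Y : vfield M) :
  push_field phi (sectionD X Y) = sectionD (push_field phi X) (push_field phi Y).
Proof. by apply: section_ext => p; exact: differentialD. Qed.

Lemma push_fieldM (a : cinf M) (X : vfield M) :
  push_field phi (sectionM a X) = sectionM a (push_field phi X).
Proof. by apply: section_ext => p; exact: differentialZ. Qed.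

Variables (g : metric M) (DM : affine_connection M) (DN : affine_connection N).
Variables (D : connection phi) (E : 'I_m -> vfield M) (F : 'I_n -> vfield N).
Variables (h : metric N).
Hypothesis onE : orthonormal_frame g E.
Hypothesis onF : orthonormal_frame h F.

(** [extend (E i p)] agrees with [E i] only at [p]. The second fundamental form does not see the
    difference: the terms [v(a) dphi(X)] of its two Leibniz rules cancel. *)
Lemma tension_frame p :
  trace_g g (@second_fundamental_form _ _ _ _ _ DM phi D p) =
  \sum_i (D p (E i p) (push_field phi (E i)) - differential phi (DM p (E i p) (E i))).
Proof.
pose T v (X : vfield M) : tangent (phi p) :=
  D p v (push_field phi X) - differential phi (DM p v X).
have TD v X X' : T v (sectionD X X') = T v X + T v X'.
  by rewrite /T push_fieldD !covD differentialD opprD addrACA.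
have TM v (a : cinf M) X : T v (sectionM a X) = a p *: T v X.
  rewrite /T push_fieldM !cov_leibniz differentialD !differentialZ.
  by apply: tangent_ext => u; rewrite !pointE; ring.
rewrite (trace_gE (onE p)).
- by apply: eq_bigr => i _; exact: (tensorial_extend onE (E i) (TD _) (TM _)).
- move=> a v v' w; rewrite /second_fundamental_form !cov_linear.
  rewrite differentialD differentialZ.
  by apply: tangent_ext => u; rewrite !pointE; ring.
- by move=> a v w w'; exact: (tensorial_extend_linear onE (TD v) (TM v)).
Qed.

(** Again tensoriality in the extended slot: the term [v(a) D_X V] occurs in both halves of the
    Hessian and cancels. *)
Lemma second_derivative_frame (V : section phi) p :
  trace_g g (@second_derivative _ _ _ _ _ DM phi D V p) =
  \sum_i (D p (E i p) (cov_section D (E i) V) - D p (DM p (E i p) (E i)) V).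
Proof.
pose T v (X : vfield M) : tangent (phi p) :=
  D p v (cov_section D X V) - D p (DM p v X) V.
have TD v X X' : T v (sectionD X X') = T v X + T v X'.
  rewrite /T covD covDl.
  have -> : cov_section D (sectionD X X') V =
      sectionD (cov_section D X V) (cov_section D X' V).
    by apply: section_ext => q /=; rewrite covDl.
  by rewrite covD opprD addrACA.
have TM v (a : cinf M) X : T v (sectionM a X) = a p *: T v X.
  rewrite /T cov_leibniz covDl !covZl.
  have -> : cov_section D (sectionM a X) V = sectionM a (cov_section D X V).
    by apply: section_ext => q /=; rewrite covZl.
  rewrite cov_leibniz.
  by apply: tangent_ext => u; rewrite !pointE; ring.
rewrite (trace_gE (onE p)).
- by apply: eq_bigr => i _; exact: (tensorial_extend onE (E i) (TD _) (TM _)).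
- move=> a v v' w; rewrite /second_derivative !cov_linear.
  by apply: tangent_ext => u; rewrite !pointE; ring.
- by move=> a v w w'; exact: (tensorial_extend_linear onE (TD v) (TM v)).
Qed.

Lemma curvature_trace_frame p (t : tangent (phi p)) :
  trace_g g (fun v w : tangent p =>
      curvature DN (differential phi v) t (differential phi w)) =
  \sum_i curvature DN (differential phi (E i p)) t (differential phi (E i p)).
Proof.
rewrite (trace_gE (onE p)) // => a v.
  by move=> v' w; rewrite differentialD differentialZ (curvature_linear1 _ onF).
by move=> w w'; rewrite differentialD differentialZ (curvature_linear3 _ onF).
Qed.

End Differential.

(** * The submersion: vanishing of [sigma] and [f1], then the tension, bitension and f-bitension
    fields *)

Section Submersion.
Set Implicit Arguments.
Unset Strict Implicit.
Variables (R : realType) (c : R).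
Variables (M : manifold R 3) (g : metric M) (DM : affine_connection M).
Variables (N : manifold R 2) (h : metric N) (DN : affine_connection N).
Variables (pi : smap M N) (D : connection pi).
Variables (e1 e2 e3 : vfield M) (eps1 eps2 : vfield N).
Variables (f1 f2 kappa1 kappa2 sigma : cinf M).
Hypothesis lcM : levi_civita g DM.
Hypothesis lcN : levi_civita h DN.
Hypothesis pbD : is_pullback_connection DN D.
Hypothesis ccM : constant_curvature g DM c.
Hypothesis ccN : constant_curvature h DN c.
Hypothesis adapted : adapted_frame g h pi e1 e2 e3 eps1 eps2.
Hypothesis idata : integrability_data e1 e2 e3 f1 f2 kappa1 kappa2 sigma.
Hypothesis kappa2_0 : forall p : M, kappa2 p = 0.
Hypothesis kappa1_neq0 : forall p : M, kappa1 p != 0.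

Let onM : orthonormal_frame g (tnth [tuple e1; e2; e3]).
Proof. by case: adapted. Qed.
Let onN : orthonormal_frame h (tnth [tuple eps1; eps2]).
Proof. by case: adapted. Qed.
Let dpi1 p : differential pi (e1 p) = eps1 (pi p).
Proof. by case: adapted => _ _ _ _ /(_ p)[]. Qed.
Let dpi2 p : differential pi (e2 p) = eps2 (pi p).
Proof. by case: adapted => _ _ _ _ /(_ p)[]. Qed.
Let dpi3 p : differential pi (e3 p) = 0.
Proof. by case: adapted => _ _ /(_ p). Qed.

Let F1 : cinf N := metric_app h (bracket eps1 eps2) eps1.
Let F2 : cinf N := metric_app h (bracket eps1 eps2) eps2.

Let brN q : bracket eps1 eps2 q = F1 q *: eps1 q + F2 q *: eps2 q.
Proof. exact: (surface_coord onN). Qed.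

(** Since [e1], [e2] are related to [eps1], [eps2], so are their brackets, and [dpi] kills the [e3]
    part. Hence [f1], [f2] are pulled back from the base, and the Gauss formula on [N] lifts to
    [M]. *)
Let fF p : f1 p = F1 (pi p) /\ f2 p = F2 (pi p).
Proof.
have [_ _ b12] := idata p; have G := surface_gram onN (pi p).
have := differential_bracket dpi1 dpi2 p; rewrite b12.
rewrite !(differentialD, differentialN, differentialZ) dpi1 dpi2 dpi3 scaler0 subr0.
rewrite brN => E.
have := congr1 (fun v => h (pi p) v (eps1 (pi p))) E.
have := congr1 (fun v => h (pi p) v (eps2 (pi p))) E.
rewrite /= !(metricDl, metricZl) !G !mulr0 !mulr1 !addr0 !add0r.
by [].
Qed.

Let f1_pull : f1 = pullback pi F1.
Proof. by apply/val_inj/funext => p; have [E _] := fF p. Qed.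
Let f2_pull : f2 = pullback pi F2.
Proof. by apply/val_inj/funext => p; have [_ E] := fF p. Qed.

Let gaussE p : e1 p f2 - e2 p f1 - f1 p ^+ 2 - f2 p ^+ 2 = c.
Proof.
rewrite -(gauss_curvature lcN onN brN (pi p) ccN) -dpi1 -dpi2.
by rewrite f1_pull f2_pull.
Qed.

(* O'Neill: the horizontal plane and its image have the same curvature c. *)
Lemma sigma_eq0 p : sigma p = 0.
Proof.
have G := frame_gram onM p.
have := @constant_curvature_orthogonal _ _ _ g DM c p (e1 p) (e2 p) 1 ccM
  (oner_neq0 _).
rewrite !G mulr1 (curvatureE _ onM) (curvature_122 lcM onM idata kappa2_0) gaussE.
move=> /(_ erefl erefl erefl) E; apply/eqP; rewrite -sqrf_eq0; apply/eqP.
by lra.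
Qed.

Let cst := constant_curvature_frame lcM onM idata kappa2_0 sigma_eq0 ccM.
Let jac := jacobi_frame onM idata kappa2_0 sigma_eq0.

Lemma f1_eq0 p : f1 p = 0.
Proof.
have [_ _ E] := cst p; have := jac p; rewrite E => J.
have /eqP : kappa1 p * f1 p = 0 by lra.
by rewrite mulf_eq0 (negPf (kappa1_neq0 p)) /= => /eqP.
Qed.

Lemma e2_kappa1 p : e2 p kappa1 = 0.
Proof. by have [_ _ ->] := cst p; rewrite f1_eq0 mulr0. Qed.

Lemma f2E p : f2 p = - c / kappa1 p.
Proof. by have [_ <- _] := cst p; rewrite opprK mulrAC divff ?mul1r. Qed.

(** Differentiating the constant product [kappa1 f2 = - c] in place of the quotient [- c / kappa1]
    makes the Leibniz rule suffice. *)
Lemma e2_f2 p : e2 p f2 = 0.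
Proof.
have -> : e2 p f2 = (e2 p (kappa1 * f2) - f2 p * e2 p kappa1) / kappa1 p.
  by rewrite tangent_leibniz addrK mulrAC divff ?mul1r.
rewrite (@tangent_cst _ _ _ _ _ _ (- c)) ?e2_kappa1 ?mulr0 ?subr0 ?mul0r //.
by move=> q; rewrite cinf_mulE f2E mulrC divfK.
Qed.

Let P1 := pull_field pi eps1.
Let P2 := pull_field pi eps2.

Let covM p :
  ((DM p (e1 p) e1 = 0) * (DM p (e2 p) e2 = f2 p *: e1 p) *
   (DM p (e3 p) e3 = kappa1 p *: e1 p))%type.
Proof.
have fc := frame_cov lcM onM idata kappa2_0 p.
by rewrite !fc f1_eq0 oppr0 scale0r.
Qed.

(** By [pbD] these are derivatives of [eps1], [eps2] along the [dpi]-image of the direction, so [P1]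
    and [P2] are parallel along the fibres. *)
Let covP p :
  ((D p (e1 p) P1 = 0) * (D p (e1 p) P2 = 0) * (D p (e2 p) P1 = - f2 p *: P2 p)
   * (D p (e2 p) P2 = f2 p *: P1 p) * (D p (e3 p) P1 = 0) * (D p (e3 p) P2 = 0))%type.
Proof.
have [c11 c12 c21 c22] := surface_cov lcN onN brN (pi p).
have [E1 E2] := fF p; rewrite !pbD dpi1 dpi2 dpi3 c11 c12 c21 c22 -E1 -E2 !cov0l.
by rewrite f1_eq0 oppr0 !scale0r.
Qed.

(** The horizontal terms cancel, because [dpi] carries [D_{e2} e2 = f2 e1] to the derivative of [P2]
    along [e2]. What remains is minus the image of the fibre curvature [D_{e3} e3 = kappa1 e1]. *)
Lemma tensionE : tension g DM D = sectionM (- kappa1) P1.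
Proof.
apply: to_sectionE => p; rewrite (tension_frame _ _ onM).
rewrite (sum_tnth3 (fun X : vfield M =>
  D p (X p) (push_field pi X) - differential pi (DM p (X p) X))).
have -> : push_field pi e1 = P1 by apply: section_ext => q; exact: dpi1.
have -> : push_field pi e2 = P2 by apply: section_ext => q; exact: dpi2.
rewrite [D p (e3 p) _]cov0r => [|q]; last exact: dpi3.
rewrite !covM !covP !differentialZ differential0 dpi1.
by apply: tangent_ext => u; rewrite !pointE /=; ring.
Qed.

(** The term [kappa1 f2^2] comes from rotating [P1] into [P2] and back along [e2], the term
    [- c kappa1] from the curvature of [N]. The [P2] component is [e2 (kappa1 f2)], which
    vanishes. *)
Lemma bitensionE p :
  bitension g DM DN D p =
  (- laplacian g DM kappa1 p + kappa1 p * (- c + f2 p ^+ 2)) *: P1 p.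
Proof.
rewrite /bitension tensionE (second_derivative_frame _ _ onM) (curvature_trace_frame _ onM onN).
pose V := sectionM (- kappa1) P1.
rewrite (sum_tnth3 (fun X : vfield M =>
  D p (X p) (cov_section D X V) - D p (DM p (X p) X) V)).
rewrite (sum_tnth3 (fun X : vfield M =>
  curvature DN (differential pi (X p)) (V p) (differential pi (X p)))).
rewrite (laplacian_frame onM) //.
rewrite (sum_tnth3 (fun X : vfield M =>
  X p (section_app X kappa1) - DM p (X p) X kappa1)).
have cs1 : cov_section D e1 V = sectionM (- section_app e1 kappa1) P1.
  apply: section_ext => q; rewrite cov_sectionE cov_leibniz covP tangentN.
  by apply: tangent_ext => u; rewrite !pointE; ring.
have cs2 : cov_section D e2 V = sectionM (kappa1 * f2) P2.
  apply: section_ext => q; rewrite cov_sectionE cov_leibniz covP tangentN e2_kappa1.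
  by apply: tangent_ext => u; rewrite !pointE; ring.
have cs3 : cov_section D e3 V = sectionM (- section_app e3 kappa1) P1.
  apply: section_ext => q; rewrite cov_sectionE cov_leibniz covP tangentN.
  by apply: tangent_ext => u; rewrite !pointE; ring.
have e2e2 : e2 p (section_app e2 kappa1) = 0.
  by apply: (@tangent_cst _ _ _ _ _ _ 0) => q; exact: e2_kappa1.
(* The factor [- kappa1 p] of [V p] is a function on [M], not on [N]; at a fixed point it is
   replaced by a constant function on [N], so that [curvatureE] applies. *)
have curvN (X Y Z : vfield N) (a : R) q :
    curvature DN (X q) (a *: Y q) (Z q) = a *: curv_field DN X Y Z q.
  have -> : a *: Y q = sectionM (a *: (1 : cinf N)) Y q by rewrite /= mulr1.
  by rewrite (curvatureE _ onN) curv_fieldMm /= mulr1.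
have c212 : curv_field DN eps2 eps1 eps2 (pi p) = - c *: eps1 (pi p).
  rewrite curv_field_anti (gauss_curvature_field lcN onN brN).
  by rewrite (gauss_curvature lcN onN brN (pi p) ccN) scaleNr.
rewrite cs1 cs2 cs3 !covM cov0l !covZl !cov_leibniz !covP dpi1 dpi2 dpi3.
rewrite !curvN curv_field_self c212 scaler0.
(* This is the vertical summand; its zero vector is presented as a value of the zero field. *)
have -> : curvature DN 0 (V p) 0 = 0.
  rewrite -[0]/(section0 (fun q : N => q) (pi p)) curvN /curv_field.
  have b0 : bracket (section0 _) eps1 (pi p) = 0.
    by rewrite bracket_anti bracket0r oppr0.
  rewrite b0 !cov0l [DN _ _ (cov_section _ _ _)]cov0r ?subr0 ?scaler0 // => q.
  by rewrite cov_sectionE cov0r.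
rewrite e2e2 !tangentN !tangent_leibniz e2_kappa1 e2_f2.
by apply: tangent_ext => u; rewrite !pointE; ring.
Qed.

(** The [P1] terms assemble into [Delta (f kappa1)] by the product rule for the Laplacian. The [P2]
    term arises from the gradient alone: differentiating [- kappa1 P1] along [e2] gives
    [kappa1 f2 P2 = - c P2]. *)
Lemma f_bitensionE (f : cinf M) p :
  f p *: bitension g DM DN D p + laplacian g DM f p *: tension g DM D p
    + 2%:R *: D p (grad g f p) (tension g DM D) =
  (- laplacian g DM (f * kappa1) p + f p * kappa1 p * (- c + f2 p ^+ 2)) *: P1 p
    - (2%:R * (c * e2 p f)) *: P2 p.
Proof.
rewrite bitensionE tensionE (laplacianM onM) // (grad_frame onM).
rewrite (sum_tnth3 (fun X : vfield M => X p f *: X p)).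
rewrite (sum_tnth3 (fun X : vfield M => X p f * X p kappa1)).
rewrite !covDl !covZl !cov_leibniz !covP !tangentN e2_kappa1.
have -> : c = - (kappa1 p * f2 p) by rewrite f2E mulrC divfK ?opprK.
by apply: tangent_ext => u; rewrite !pointE; ring.
Qed.

Lemma proper_f_biharmonicE (f : cinf M) :
  proper_f_biharmonic g DM DN D f <->
  [/\ (forall p : M,
         - laplacian g DM (f * kappa1) p
           + f p * kappa1 p * (- c + c ^+ 2 / kappa1 p ^+ 2) = 0),
      (forall p : M, c * e2 p f = 0)
    & ~ (forall p : M,
           - laplacian g DM kappa1 p
             + kappa1 p * (- c + c ^+ 2 / kappa1 p ^+ 2) = 0)].
Proof.
have f22 p : f2 p ^+ 2 = c ^+ 2 / kappa1 p ^+ 2 by rewrite f2E expr_div_n sqrrN.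
(* [P1] and [P2] are orthonormal at each point, so the f-biharmonic equation splits into the first
   two conditions. *)
have indep p a b : a *: P1 p + b *: P2 p = 0 -> a = 0 /\ b = 0.
  move=> ab; split; [have := congr1 (fun v => h (pi p) v (eps1 (pi p))) ab
    | have := congr1 (fun v => h (pi p) v (eps2 (pi p))) ab];
  by rewrite metricDl !metricZl metric0l !(surface_gram onN) !(mulr0, mulr1, addr0, add0r).
(* The bitension field has only a [P1] component, so the third condition is exactly the failure of
   biharmonicity: its left side is not identically zero. *)
have biharmonicE : biharmonic g DM DN D <-> forall p : M,
    - laplacian g DM kappa1 p + kappa1 p * (- c + c ^+ 2 / kappa1 p ^+ 2) = 0.
  split=> H p; last by rewrite bitensionE f22 H scale0r.
  have := H p; rewrite bitensionE f22 => E.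
  by apply: (proj1 (indep p _ 0 _)); rewrite E scale0r addr0.
rewrite /proper_f_biharmonic biharmonicE; split.
  move=> [F nB].
  have F0 p : - laplacian g DM (f * kappa1) p
      + f p * kappa1 p * (- c + c ^+ 2 / kappa1 p ^+ 2) = 0 /\
      - (2%:R * (c * e2 p f)) = 0.
    by apply: (indep p); rewrite scaleNr -f22 -f_bitensionE.
  split=> // p; first by have [] := F0 p.
  by have [_ /eqP] := F0 p; rewrite oppr_eq0 mulf_eq0 pnatr_eq0 => /eqP.
move=> [A B nB]; split=> // p.
by rewrite f_bitensionE f22 A B mulr0 !scale0r subr0.
Qed.

End Submersion.

Theorem theorem4p1 (R : realType) (c : R)
    (M : manifold R 3) (g : metric M) (DM : affine_connection M)
    (N : manifold R 2) (h : metric N) (DN : affine_connection N)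
    (pi : smap M N) (D : connection pi)
    (e1 e2 e3 : vfield M) (eps1 eps2 : vfield N)
    (f1 f2 kappa1 kappa2 sigma : cinf M) (f : cinf M) :
  levi_civita g DM -> levi_civita h DN -> is_pullback_connection DN D ->
  constant_curvature g DM c -> constant_curvature h DN c ->
  riemannian_submersion g h pi ->
  adapted_frame g h pi e1 e2 e3 eps1 eps2 ->
  integrability_data e1 e2 e3 f1 f2 kappa1 kappa2 sigma ->
  (forall p : M, kappa2 p = 0) ->
  (forall p : M, kappa1 p != 0) ->
  (forall p : M, 0 < f p) ->
  proper_f_biharmonic g DM DN D f <->
  [/\ (forall p : M,
         - laplacian g DM (f * kappa1) p
           + f p * kappa1 p * (- c + c ^+ 2 / kappa1 p ^+ 2) = 0),
      (forall p : M, c * e2 p f = 0)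
    & ~ (forall p : M,
           - laplacian g DM kappa1 p
             + kappa1 p * (- c + c ^+ 2 / kappa1 p ^+ 2) = 0)].
Proof.
move=> lcM lcN pbD ccM ccN _ adapted idata k2 k1 _.
exact: (proper_f_biharmonicE lcM lcN pbD ccM ccN adapted idata k2 k1).
Qed.
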